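(* Let $\Lambda=(W_j,\Lambda_j,v_j)_{j\in\mathbb{J}}$ be a g-fusion frame sequence, where each $W_j$ is a closed subspace of $H$, $\Lambda_j\in\mathcal{B}(H,H_j)$ and $v_j>0$. Then $\Lambda$ is a g-fusion frame for $H$ if and only if the map $f\mapsto\{v_j\Lambda_j\pi_{W_j}f\}_{j\in\mathbb{J}}$ from $H$ onto a closed subspace of $\mathscr{H}_2$ is injective.
   Context: $H$ is a separable Hilbert space, $\mathbb{J}\subseteq\mathbb{Z}$, and $\{H_j\}_{j\in\mathbb{J}}$ is a family of Hilbert spaces. $\mathcal{B}(H,H_j)$ is the set of bounded linear operators from $H$ to $H_j$, and $\pi_V$ is the orthogonal projection of $H$ onto a closed subspace $V$. $\mathscr{H}_2=\{\{f_j\}_{j\in\mathbb{J}}: f_j\in H_j,\ \sum_{j\in\mathbb{J}}\|f_j\|^2<\infty\}$ is the Hilbert space with inner product $\langle\{f_j\},\{g_j\}\rangle=\sum_j\langle f_j,g_j\rangle$. $\Lambda$ is a g-fusion frame for $H$ if there exist $0<A\le B<\infty$ such that $A\|f\|^2\le\sum_{j\in\mathbb{J}}v_j^2\|\Lambda_j\pi_{W_j}f\|^2\le B\|f\|^2$ for all $f\in H$. Write $M=\overline{\mathrm{span}}\{\pi_{W_j}\Lambda_j^*H_j\}_{j\in\mathbb{J}}$, the closed linear span in $H$ of all the subspaces $\pi_{W_j}\Lambda_j^*(H_j)$. $\Lambda$ is a g-fusion frame sequence if it is a g-fusion frame for $M$, i.e. there exist $0<A\le B<\infty$ such that the same inequalities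 hold for all $f\in M$. For a g-fusion frame sequence, the map $f\mapsto\{v_j\Lambda_j\pi_{W_j}f\}_{j\in\mathbb{J}}$ is defined on all of $H$ with values in $\mathscr{H}_2$ and has closed range. *)

(* Defs.v *)
From HB Require Import structures.
From mathcomp Require Import all_boot all_order all_algebra.
From mathcomp Require Import sesquilinear.
From mathcomp Require Import all_classical all_reals all_analysis.
From mathcomp Require Import complex.

Set Implicit Arguments.
Unset Strict Implicit.
Unset Printing Implicit Defensive.

Import Order.TTheory GRing.Theory Num.Theory.
Import numFieldNormedType.Exports.

Local Open Scope classical_set_scope.
Local Open Scope ring_scope.

(* The ground field of a Hilbert space is either the reals or the complex     *)
(* numbers; scalar_field R k is that field, over the model R of the reals.    *)
Variant scalar_kind := RealScalars | ComplexScalars.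

Definition scalar_field (R : realType) (k : scalar_kind) : numFieldType :=
  match k with RealScalars => R | ComplexScalars => R[i] end.

Definition conj_scalar (R : realType) (k : scalar_kind) :
    scalar_field R k -> scalar_field R k :=
  match k with RealScalars => idfun | ComplexScalars => @conjc R end.

Definition re_scalar (R : realType) (k : scalar_kind) : scalar_field R k -> R :=
  match k with RealScalars => idfun | ComplexScalars => @complex.Re R end.

Definition of_real (R : realType) (k : scalar_kind) : R -> scalar_field R k :=
  match k with RealScalars => idfun | ComplexScalars => fun x => Complex x 0 end.

(* The inner product is linear in its first argument and conjugate-linear in  *)
(* the second; it induces the norm of the underlying Banach space.            *)
HB.mixin Record NormedModule_hasInner (R : realType) (k : scalar_kind) V
    & NormedModule (scalar_field R k) V := {
  inner : {dot V for @conj_scalar R k};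
  inner_norm : forall x : V, inner x x = `|x| ^+ 2
}.

#[short(type="hilbertType")]
HB.structure Definition Hilbert (R : realType) (k : scalar_kind) :=
  {V of CompleteNormedModule (scalar_field R k) V & NormedModule_hasInner R k V}.

Section HilbertSpaces.
Context {R : realType} {k : scalar_kind}.
Implicit Types H G : hilbertType R k.

(* The library norm of a complex normed space takes its values in R[i]        *)
(* (on the nonnegative real axis); hnorm is the same norm with values in R.   *)
Definition hnorm H (x : H) : R := re_scalar `|x|.

Definition separable H : Prop := exists2 D : set H, countable D & dense D.

Definition subspace_set H (W : set H) : Prop :=
  W 0 /\ forall (a : scalar_field R k) x y, W x -> W y -> W (a *: x + y).

Definition closed_subspace H (W : set H) : Prop :=
  subspace_set W /\ closed W.

Definition closed_span H (S : set H) : set H :=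
  closure (smallest (@subspace_set H) S).

Definition bounded_operator H G (T : H -> G) : Prop :=
  exists c : R, forall x, hnorm (T x) <= c * hnorm x.

(* For W a closed subspace, the unique p in W with f - p orthogonal to W.     *)
Definition orthproj H (W : set H) (f : H) : H :=
  xget 0 [set p | W p /\ forall w, W w -> inner (f - p) w = 0].

(* For T bounded linear, the unique x with <T z, y> = <z, x> for all z.       *)
Definition adjoint H G (T : H -> G) (y : G) : H :=
  xget 0 [set x | forall z, inner (T z) y = inner z x].

End HilbertSpaces.

Section L2Sum.
Context {R : realType} {k : scalar_kind} {J : set int}.
Variable Hs : J -> hilbertType R k.

Definition l2norm_sqr (g : forall j, Hs j) : \bar R :=
  (\esum_(j in [set: J]) ((hnorm (g j)) ^+ 2)%:E)%E.

(* The Hilbert space direct sum of the H_j, as a set of families.             *)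
Definition l2sum : set (forall j, Hs j) := [set g | (l2norm_sqr g < +oo)%E].

(* Closedness is with respect to the norm of l2sum.                           *)
Definition l2_closed_subspace (A : set (forall j, Hs j)) : Prop :=
  [/\ A `<=` l2sum,
      A (fun=> 0),
      forall (a : scalar_field R k) f g, A f -> A g -> A (fun j => a *: f j + g j)
    & forall g, l2sum g ->
      (forall e : R, 0 < e ->
        exists2 f, A f & (l2norm_sqr (fun j => g j - f j)%R < (e ^+ 2)%:E)%E) ->
      A g].

End L2Sum.

Section GFusionFrames.
Context {R : realType} {k : scalar_kind} {J : set int}.
Context {H : hilbertType R k} {Hs : J -> hilbertType R k}.
Variables (W : J -> set H) (L : forall j, H -> Hs j) (v : J -> R).

Definition gfusion_frame_for (M : set H) : Prop :=
  exists A B : R, [/\ 0 < A, A <= B &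
    forall f, M f ->
      ((A * hnorm f ^+ 2)%:E <=
         \esum_(j in [set: J])
            (v j ^+ 2 * hnorm (L j (orthproj (W j) f)) ^+ 2)%:E
       <= (B * hnorm f ^+ 2)%:E)%E].

Definition gfusion_frame : Prop := gfusion_frame_for [set: H].

Definition gfusion_span : set H :=
  closed_span
    (\bigcup_(j in [set: J])
       range (fun g : Hs j => orthproj (W j) (adjoint (L j) g))).

Definition gfusion_frame_sequence : Prop := gfusion_frame_for gfusion_span.

Definition gfusion_analysis (f : H) : forall j, Hs j :=
  fun j => of_real k (v j) *: L j (orthproj (W j) f).

End GFusionFrames.

(* Main.v *)
Require Import Defs.
From mathcomp Require Import all_boot all_order all_algebra.
From mathcomp Require Import all_classical all_reals all_analysis.
From mathcomp Require Import sesquilinear complex ring lra.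

Set Implicit Arguments.
Unset Strict Implicit.
Unset Printing Implicit Defensive.

Import Order.TTheory GRing.Theory Num.Theory.
Import numFieldNormedType.Exports.

Local Open Scope classical_set_scope.
Local Open Scope ring_scope.

(** Let [T f] be the family of the [v_j L_j P_j f], where [P_j] is the
    orthogonal projection onto [W_j], and let [M] be the closed span of the
    ranges of the [P_j L_j^*].  Since [P_j] is self-adjoint,
    [<L_j P_j f, g> = <f, P_j L_j^* g>], so [T] vanishes on the orthogonal
    complement of [M] (analysis_orthogonal).  Hence [T f] depends only on the
    projection of [f] onto [M] (analysis_orthproj), and [T] is entirely
    governed by its restriction to [M], where the frame inequalities hold.

    - The upper frame bound on [M] puts the range of [T] inside the direct
      sum.  The lower bound makes the restriction of [T] to [M] bounded below,
      so that approximants [T u_n] of a family [g] come from a Cauchy sequence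
      [u_n] in [M]; its limit is a preimage of [g], because each coordinate of
      [T] is bounded (range_analysis_closed).

    - A lower frame bound on the whole space forces the kernel of [T] to be
      zero (frame_analysis_injective).  Conversely, if [T] is injective then
      every [f] equals its projection onto [M], because both have the same
      image; so [M] is the whole space and the frame sequence is a frame
      (analysis_injective_frame).

    Projections and adjoints are given by a choice operator, and they mean
    what they should only once the defining property is known to be
    satisfiable.  The projection theorem (orthprojP) and the Riesz
    representation theorem (riesz, adjointP) supply this, by one argument for
    the real and the complex field; nearest points exist because the
    parallelogram law makes minimizing sequences Cauchy. *)

(** * Real and complex scalars *)

Section Scalars.
Context {R : realType} {k : scalar_kind}.
Local Notation K := (scalar_field R k).
Local Notation "r %:K" := (of_real k r) (at level 2, format "r %:K").
Implicit Types (r s : R) (a b : K).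

Lemma re_of_real r : re_scalar r%:K = r.
Proof. by case: k. Qed.

Lemma of_real0 : 0%:K = 0 :> K.
Proof. by case: k. Qed.

Lemma of_realD r s : (r + s)%:K = r%:K + s%:K.
Proof. by case: k => //=; exact: (rmorphD (@real_complex R)). Qed.

Lemma of_real_nat n : (n%:R)%:K = n%:R :> K.
Proof. by case: k => //=; exact: (rmorph_nat (@real_complex R)). Qed.

Lemma of_realM r s : (r * s)%:K = r%:K * s%:K.
Proof. by case: k => //=; exact: (rmorphM (@real_complex R)). Qed.

Lemma of_realX r : (r ^+ 2)%:K = r%:K ^+ 2.
Proof. by rewrite !expr2 of_realM. Qed.

Lemma ler_of_real r s : (r%:K <= s%:K) = (r <= s).
Proof. by case: k => //=; exact: lecR. Qed.

Lemma of_real_inj : injective (@of_real R k).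
Proof. by move=> r s /(congr1 (@re_scalar R k)); rewrite !re_of_real. Qed.

Lemma ltr_of_real r s : (r%:K < s%:K) = (r < s).
Proof. by rewrite !lt_def ler_of_real (inj_eq of_real_inj). Qed.

Lemma re_scalarK a : 0 <= a -> (re_scalar a)%:K = a.
Proof.
by case: k a => //= -[x y]; rewrite lecE /= => /andP[/eqP <- _].
Qed.

Lemma re_normr_ge0 a : 0 <= re_scalar `|a|.
Proof. by rewrite -ler_of_real of_real0 re_scalarK. Qed.

Lemma conj_scalarK : involutive (@conj_scalar R k).
Proof. by case: k => //= a; exact: conjcK. Qed.

Lemma conj_scalar0 : conj_scalar 0 = 0 :> K.
Proof. by case: k => //=; rewrite raddf0. Qed.

Lemma conj_of_real r : conj_scalar r%:K = r%:K.
Proof. by case: k => //=; rewrite /of_real oppr0. Qed.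

Lemma mul_conj_scalar a : a * conj_scalar a = `|a| ^+ 2.
Proof.
case: k a => /= a; last by rewrite sqr_normc.
by rewrite real_normK ?num_real // expr2.
Qed.

End Scalars.

Local Notation "r %:K" := (of_real _ r) (at level 2, format "r %:K").

(** * Inner product and norm *)

Section InnerProduct.
Context {R : realType} {k : scalar_kind} {H : hilbertType R k}.
Local Notation K := (scalar_field R k).
Implicit Types (x y z : H) (a : K).

Lemma innerC x y : inner x y = conj_scalar (inner y x).
Proof.
(* Hermitian symmetry of a form carries a sign, here trivial. *)
have -> : inner x y = (-1) ^+ false * conj_scalar (inner y x).
  by case: (inner) => [? [? ? []]] /=.
by rewrite mul1r.
Qed.

Lemma innerDl x y z : inner (x + y) z = inner x z + inner y z.
Proof. exact: linearDl. Qed.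

Lemma innerDr x y z : inner x (y + z) = inner x y + inner x z.
Proof. exact: linearDr. Qed.

Lemma innerBl x y z : inner (x - y) z = inner x z - inner y z.
Proof. exact: linearBl. Qed.

Lemma innerBr x y z : inner x (y - z) = inner x y - inner x z.
Proof. exact: linearBr. Qed.

Lemma innerZl a x y : inner (a *: x) y = a * inner x y.
Proof. exact: linearZl_LR. Qed.

Lemma innerZr a x y : inner x (a *: y) = conj_scalar a * inner x y.
Proof. exact: linearZr_LR. Qed.

Lemma inner0r x : inner x 0 = 0.
Proof. exact: linear0r. Qed.

Lemma inner_eq0C x y : inner x y = 0 -> inner y x = 0.
Proof. by rewrite (innerC y) => ->; rewrite conj_scalar0. Qed.

Lemma of_real_hnorm x : (hnorm x)%:K = `|x| :> K.
Proof. exact: re_scalarK. Qed.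

Lemma inner_hnorm x : inner x x = (hnorm x ^+ 2)%:K :> K.
Proof. by rewrite inner_norm of_realX of_real_hnorm. Qed.

Lemma hnorm_ge0 x : 0 <= hnorm x.
Proof. by rewrite -(@ler_of_real R k) of_real0 of_real_hnorm. Qed.

Lemma hnorm0_eq0 x : hnorm x = 0 -> x = 0.
Proof.
by move=> x0; apply: (@normr0_eq0 _ _ x); rewrite -of_real_hnorm x0 of_real0.
Qed.

Lemma hnorm0 : hnorm (0 : H) = 0.
Proof. by apply: (@of_real_inj R k); rewrite of_real_hnorm normr0 of_real0. Qed.

Lemma inner_eq0 x : inner x x = 0 -> x = 0.
Proof.
rewrite inner_hnorm -[RHS](@of_real0 R k) => /of_real_inj/eqP.
by rewrite sqrf_eq0 => /eqP/hnorm0_eq0.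
Qed.

Lemma ler_hnormD x y : hnorm (x + y) <= hnorm x + hnorm y.
Proof. by rewrite -(@ler_of_real R k) of_realD !of_real_hnorm ler_normD. Qed.

Lemma hnorm_distC x y : hnorm (x - y) = hnorm (y - x).
Proof. by rewrite /hnorm distrC. Qed.

Lemma hnormZ a x : hnorm (a *: x) = re_scalar `|a| * hnorm x.
Proof.
apply: (@of_real_inj R k).
by rewrite of_realM !of_real_hnorm re_scalarK // normrZ.
Qed.

Lemma pythagoras x y : inner x y = 0 ->
  hnorm (x + y) ^+ 2 = hnorm x ^+ 2 + hnorm y ^+ 2.
Proof.
move=> xy; apply: (@of_real_inj R k).
rewrite of_realD -!inner_hnorm innerDl !innerDr xy (inner_eq0C xy).
by rewrite addr0 add0r.
Qed.

Lemma parallelogram x y :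
  hnorm (x + y) ^+ 2 + hnorm (x - y) ^+ 2 =
  2 * hnorm x ^+ 2 + 2 * hnorm y ^+ 2.
Proof.
apply: (@of_real_inj R k).
rewrite !mulr_natl !mulr2n !of_realD -!inner_hnorm.
rewrite innerBl !innerBr innerDl !innerDr.
ring.
Qed.

Lemma orthogonal_component x y : y != 0 ->
  inner (x - (inner x y / inner y y) *: y) y = 0.
Proof.
move=> y0; rewrite innerBl innerZl divfK ?subrr //.
by apply: contra_neq y0 => /inner_eq0.
Qed.

(** Pythagoras for the decomposition of [x] along the line of [y]: the common
    source of the Cauchy-Schwarz inequality and of the orthogonality of
    nearest points. *)
Lemma hnorm_component x y : y != 0 ->
  let a := inner x y / inner y y in
  hnorm x ^+ 2 = hnorm (x - a *: y) ^+ 2 + (re_scalar `|a| * hnorm y) ^+ 2.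
Proof.
move=> y0 a; rewrite -hnormZ -pythagoras ?subrK //.
by rewrite innerZr orthogonal_component // mulr0.
Qed.

Lemma cauchy_schwarz x y : re_scalar `|inner x y| <= hnorm x * hnorm y.
Proof.
have [->|y0] := eqVneq y 0.
  rewrite inner0r normr0 hnorm0 mulr0.
  by rewrite -(@of_real0 R k) re_of_real.
have {1}-> : inner x y = (inner x y / inner y y) * inner y y.
  by rewrite divfK //; apply: contra_neq y0 => /inner_eq0.
have := hnorm_component x y0; set a := _ / _ => /= xa.
have -> : re_scalar `|a * inner y y| = re_scalar `|a| * hnorm y * hnorm y.
  apply: (@of_real_inj R k); rewrite normrM re_scalarK ?mulr_ge0 //.
  rewrite 2!of_realM re_scalarK // of_real_hnorm inner_norm normrX normr_id.
  by rewrite expr2 mulrA.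
rewrite ler_wpM2r ?hnorm_ge0 //.
rewrite -(ler_pXn2r (ltn0Sn 1)) ?nnegrE ?hnorm_ge0 //.
  by rewrite xa lerDr sqr_ge0.
by rewrite -hnormZ hnorm_ge0.
Qed.

(** If subtracting multiples of [y] never shortens [x], then in particular
    removing the component of [x] along [y] does not; by [hnorm_component]
    that component is zero. *)
Lemma nearest_orthogonal x y :
  (forall a : K, hnorm x <= hnorm (x - a *: y)) -> inner x y = 0.
Proof.
move=> xmin; have [->|y0] := eqVneq y 0; first exact: inner0r.
have := hnorm_component x y0; set a := _ / _ => /= xa.
suff a0 : a = 0.
  have yy0 : inner y y != 0 by apply: contra_neq y0 => /inner_eq0.
  by rewrite -[LHS](divfK yy0) -/a a0 mul0r.
suff : a *: y = 0 by move=> /eqP; rewrite scaler_eq0 (negPf y0) orbF => /eqP.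
apply/hnorm0_eq0/eqP; rewrite -sqrf_eq0 eq_le sqr_ge0 andbT hnormZ.
rewrite -(lerD2l (hnorm (x - a *: y) ^+ 2)) -xa addr0.
by rewrite lerXn2r ?nnegrE ?hnorm_ge0.
Qed.

End InnerProduct.

(** * Closure and completeness in terms of the real norm *)

Section Topology.
Context {R : realType} {k : scalar_kind} {H : hilbertType R k}.
Local Notation K := (scalar_field R k).
Implicit Types (x y : H) (A W : set H).

Lemma ball_hnorm x y (e : R) : ball x e%:K y <-> hnorm (x - y) < e.
Proof. by rewrite -ball_normE /ball_ /= -of_real_hnorm ltr_of_real. Qed.

(** Balls have radii in the scalar field, possibly complex; this and
    [hnorm_complete] restate what is needed of the topology with real
    radii, uniformly in the two fields. *)
Lemma closure_hnorm A x :
  closure A x <-> forall e : R, 0 < e -> exists2 a, A a & hnorm (x - a) < e.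
Proof.
split=> [clAx e e0|approx B /nbhs_ballP[e /= e0 xB]].
  have eK : 0 < e%:K :> K by rewrite -(@of_real0 R k) ltr_of_real.
  have [a [Aa /ball_hnorm xa]] := clAx _ (nbhsx_ballx x e%:K eK).
  by exists a.
have eE : (re_scalar e)%:K = e by rewrite re_scalarK // ltW.
have [|a Aa /ball_hnorm xa] := approx (re_scalar e).
  by rewrite -(@ltr_of_real R k) eE of_real0.
by exists a; split=> //; apply: xB; rewrite -eE.
Qed.

Lemma hnorm_complete (u : nat -> H) :
  (forall e : R, 0 < e -> exists N, forall n m, (N <= n)%N -> (N <= m)%N ->
     hnorm (u n - u m) < e) ->
  exists p, forall e : R, 0 < e -> exists N, forall n, (N <= n)%N ->
    hnorm (p - u n) < e.
Proof.
move=> uC.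
have reK (e : K) : 0 < e -> 0 < re_scalar e /\ (re_scalar e)%:K = e.
  move=> e0; have eE : (re_scalar e)%:K = e by rewrite re_scalarK // ltW.
  by rewrite -(@ltr_of_real R k) eE of_real0.
have : cauchy (u n @[n --> \oo]).
  apply/cauchyP => e e0; have [re0 eE] := reK _ e0.
  have [N uN] := uC _ re0; exists (u N).
  exists N => // n /= Nn; rewrite -eE; apply/ball_hnorm; exact: uN.
move/cauchy_cvg => cvgu.
exists (lim (u n @[n --> \oo])) => e e0.
have eK : 0 < e%:K :> K by rewrite -(@of_real0 R k) ltr_of_real.
have /cvgrPdist_lt/(_ _ eK)[N _ uN] :
    u n @[n --> \oo] --> lim (u n @[n --> \oo]) by exact: cvgu.
by exists N => n Nn; have := uN n Nn; rewrite -of_real_hnorm ltr_of_real.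
Qed.

Lemma inv_succ_small (e : R) : 0 < e ->
  exists N, forall n, (N <= n)%N -> n.+1%:R^-1 < e.
Proof.
by move=> e0; have [N _ NP] := near_infty_natSinv_lt (PosNum e0); exists N.
Qed.

(** Minimizing sequences and sequences of approximate preimages both arrive
    with an estimate of this form on the squared distances of their terms. *)
Lemma closed_quasi_cauchy W (c : R) (u : nat -> H) : closed W ->
  (forall n, W (u n)) ->
  (forall n m, hnorm (u n - u m) ^+ 2 <= c * (n.+1%:R^-1 + m.+1%:R^-1)) ->
  exists2 p, W p & forall e : R, 0 < e -> exists N, forall n, (N <= n)%N ->
    hnorm (p - u n) < e.
Proof.
move=> clW Wu uc.
have c0 : 0 <= c.
  have := le_trans (sqr_ge0 _) (uc 0 0)%N.
  by rewrite pmulr_lge0 // addr_gt0.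
have [|p pu] := @hnorm_complete u.
  move=> e e0.
  have [|N NP] := @inv_succ_small (e ^+ 2 / (2 * (c + 1))).
    by rewrite divr_gt0 ?exprn_gt0 //; lra.
  exists N => n m /NP Nn /NP Nm.
  rewrite -(ltr_pXn2r (ltn0Sn 1)) ?nnegrE ?hnorm_ge0 ?(ltW e0) //.
  apply: le_lt_trans (uc n m) _.
  rewrite ltr_pdivlMr in Nn; last lra.
  rewrite ltr_pdivlMr in Nm; last lra.
  have := invr_gt0 (n.+1%:R : R); have := invr_gt0 (m.+1%:R : R).
  rewrite !ltr0Sn; move: n.+1%:R^-1 m.+1%:R^-1 Nn Nm => a b; nra.
exists p => //; apply: clW; apply/closure_hnorm => e /pu[N pN].
by exists (u N); last exact: pN.
Qed.

End Topology.

(** * Projections and adjoints *)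

Section Projection.
Context {R : realType} {k : scalar_kind} {H : hilbertType R k}.
Local Notation K := (scalar_field R k).
Implicit Types (x y f w : H) (W : set H).

Lemma subspaceD W x y : subspace_set W -> W x -> W y -> W (x + y).
Proof. by move=> [_ Wl] Wx Wy; rewrite -[x]scale1r; apply: Wl. Qed.

Lemma subspaceZ W (a : K) x : subspace_set W -> W x -> W (a *: x).
Proof. by move=> [W0 Wl] Wx; rewrite -[_ *: _]addr0; apply: Wl. Qed.

Lemma subspaceB W x y : subspace_set W -> W x -> W y -> W (x - y).
Proof.
by move=> Ws Wx Wy; rewrite -scaleN1r; apply: subspaceD => //; exact: subspaceZ.
Qed.

(** The midpoint of [x] and [y] lies in [W], hence at distance at least [d]
    from [f]; the parallelogram law then leaves little room for [x - y].  The
    constant comes from [(d + c)^2 <= d^2 + (2 d + 1) c] for [0 <= c <= 1]. *)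
Lemma nearly_minimal_close W f x y (d a b : R) : subspace_set W ->
  (forall w, W w -> d <= hnorm (f - w)) -> 0 <= d ->
  W x -> W y -> 0 <= a <= 1 -> 0 <= b <= 1 ->
  hnorm (f - x) <= d + a -> hnorm (f - y) <= d + b ->
  hnorm (x - y) ^+ 2 <= (4 * d + 2) * (a + b).
Proof.
move=> Ws dmin d0 Wx Wy /andP[a0 a1] /andP[b0 b1] xa yb.
have := parallelogram (f - x) (f - y).
have -> : (f - x) - (f - y) = y - x by rewrite opprB addrC addrA subrK.
have two : 2 != 0 :> K by rewrite pnatr_eq0.
have -> : (f - x) + (f - y) = (2 : K) *: (f - (2 : K)^-1 *: (x + y)).
  rewrite scalerBr scalerA divff // scale1r scaler_nat mulr2n.
  by rewrite opprD addrACA.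
rewrite hnormZ (hnorm_distC y).
have -> : re_scalar `|2 : K| = 2.
  by rewrite normr_nat -[2%:R](@of_real_nat R k) re_of_real.
have := dmin _ (subspaceZ (2 : K)^-1 Ws (subspaceD Ws Wx Wy)).
have sqr_le (t c : R) : 0 <= t -> 0 <= c <= 1 -> t <= d + c ->
    t ^+ 2 <= d ^+ 2 + (2 * d + 1) * c.
  by move=> t0 /andP[c0 c1] tc; nra.
have := sqr_le _ a (hnorm_ge0 (f - x)); have := sqr_le _ b (hnorm_ge0 (f - y)).
rewrite a0 b0 a1 b1 => /(_ isT yb) q2 /(_ isT xa) p2 dh.
have h2 : d ^+ 2 <= hnorm (f - (2 : K)^-1 *: (x + y)) ^+ 2.
  by rewrite lerXn2r ?nnegrE ?hnorm_ge0.
rewrite exprMn; nra.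
Qed.

Lemma nearest_point W f : closed_subspace W ->
  exists2 p, W p & forall w, W w -> hnorm (f - p) <= hnorm (f - w).
Proof.
move=> [Ws clW].
pose D := [set hnorm (f - w) | w in W]; pose d := inf D.
have D0 : lbound D 0 by move=> _ [w _ <-]; exact: hnorm_ge0.
have Dinf : has_inf D.
  by split; [exists (hnorm (f - 0)), 0; first exact: Ws.1 | exists 0].
have dmin w : W w -> d <= hnorm (f - w).
  by move=> Ww; apply: ge_inf; [exists 0 | exists w].
have d0 : 0 <= d by apply: lb_le_inf => //; exact: Dinf.1.
have invS01 n : 0 <= (n.+1%:R^-1 : R) <= 1.
  by rewrite invr_ge0 ler0n /= invf_le1 ?ltr0Sn // ler1n.
have /choice[u uP] n : exists w, W w /\ hnorm (f - w) <= d + n.+1%:R^-1.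
  have [|_ [w Ww <-] /ltW] := @inf_adherent _ D n.+1%:R^-1 _ Dinf.
    by rewrite invr_gt0 ltr0Sn.
  by exists w.
have [|n m|p Wp pu] := @closed_quasi_cauchy _ _ _ W (4 * d + 2) u clW.
- by move=> n; have [] := uP n.
- have [? ?] := uP n; have [? ?] := uP m.
  exact: (@nearly_minimal_close W f _ _ d).
exists p => // w /dmin; apply: le_trans; apply/ler_addgt0Pr => e e0.
have e2 : 0 < e / 2 by rewrite divr_gt0.
have [N1 N1P] := pu _ e2; have [N2 N2P] := inv_succ_small e2.
pose n := maxn N1 N2.
have := N1P n (leq_maxl _ _); have := N2P n (leq_maxr _ _).
have [_ fu] := uP n; have := ler_hnormD (f - u n) (u n - p).
rewrite addrA subrK (hnorm_distC (u n)); move: n.+1%:R^-1 fu => a; lra.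
Qed.

Lemma orthproj_exists W f : closed_subspace W ->
  exists p, W p /\ forall w, W w -> inner (f - p) w = 0.
Proof.
move=> cW; have [p Wp pmin] := nearest_point f cW; have [Ws _] := cW.
exists p; split=> // w Ww; apply: nearest_orthogonal => a.
rewrite -addrA -opprD; apply: pmin; apply: subspaceD => //; exact: subspaceZ.
Qed.

Lemma orthprojP W f : closed_subspace W ->
  W (orthproj W f) /\ forall w, W w -> inner (f - orthproj W f) w = 0.
Proof.
move=> cW; exact: (xgetPex 0 (orthproj_exists f cW)).
Qed.

Lemma orthproj_unique W f p : closed_subspace W -> W p ->
  (forall w, W w -> inner (f - p) w = 0) -> orthproj W f = p.
Proof.
move=> cW Wp fp; have [Wq fq] := orthprojP f cW; have [Ws _] := cW.
apply/subr0_eq/inner_eq0.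
have Wqp := subspaceB Ws Wq Wp.
have {1}-> : orthproj W f - p = (f - p) - (f - orthproj W f).
  by rewrite opprB [RHS]addrC addrA subrK.
by rewrite innerBl (fp _ Wqp) (fq _ Wqp) subrr.
Qed.

Lemma orthproj_linear W (a : K) x y : closed_subspace W ->
  orthproj W (a *: x + y) = a *: orthproj W x + orthproj W y.
Proof.
move=> cW; have [Wx ox] := orthprojP x cW; have [Wy oy] := orthprojP y cW.
have [[_ Wl] _] := cW.
apply: orthproj_unique => // [|w Ww]; first exact: Wl.
by rewrite opprD addrACA -scalerBr innerDl innerZl ox // oy // mulr0 addr0.
Qed.

Lemma hnorm_orthproj W f : closed_subspace W ->
  hnorm (orthproj W f) <= hnorm f.
Proof.
move=> cW; have [Wp op] := orthprojP f cW.
rewrite -(ler_pXn2r (ltn0Sn 1)) ?nnegrE ?hnorm_ge0 //.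
rewrite -[X in _ <= hnorm X ^+ 2](subrK (orthproj W f)) pythagoras ?op //.
by rewrite lerDr sqr_ge0.
Qed.

Lemma orthproj_selfadjoint W x y : closed_subspace W ->
  inner (orthproj W x) y = inner x (orthproj W y).
Proof.
move=> cW; have [Wx ox] := orthprojP x cW; have [Wy oy] := orthprojP y cW.
have /eqP := ox _ Wy; rewrite innerBl subr_eq0 => /eqP ->.
have /inner_eq0C/eqP := oy _ Wx; rewrite innerBr subr_eq0 => /eqP //.
Qed.

(** Taking the closure keeps a subspace because the vector space operations
    are continuous. *)
Lemma closed_span_subspace (S : set H) : closed_subspace (closed_span S).
Proof.
have Ws : subspace_set (smallest (@subspace_set R k H) S).
  split=> [V [[V0 _] _]//|a x y Vx Vy V [Vs SV]].
  by apply: Vs.2; [exact: Vx | exact: Vy].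
split; last exact: closed_closure.
split=> [|a x y /closure_hnorm Vx /closure_hnorm Vy].
  by apply: subset_closure; exact: Ws.1.
apply/closure_hnorm => e e0; set c := re_scalar `|a|.
have c0 : 0 <= c := re_normr_ge0 a.
have [|x' Vx' xx'] := Vx (e / (2 * (c + 1))).
  by rewrite divr_gt0 ?mulr_gt0 ?ltr_wpDl.
have [|y' Vy' yy'] := Vy (e / 2); first by rewrite divr_gt0.
exists (a *: x' + y'); first exact: Ws.2.
rewrite opprD addrACA -scalerBr; apply: le_lt_trans (ler_hnormD _ _) _.
rewrite hnormZ -/c.
move: xx'; rewrite ltr_pdivlMr ?mulr_gt0 ?ltr_wpDl // => xx'.
by have := hnorm_ge0 (x - x'); nra.
Qed.

Lemma sub_closed_span (S : set H) : S `<=` closed_span S.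
Proof. by move=> x Sx; apply: subset_closure => V [_]; apply. Qed.

End Projection.

Section Riesz.
Context {R : realType} {k : scalar_kind} {H G : hilbertType R k}.
Local Notation K := (scalar_field R k).

(** If [phi] is not zero, take [u] orthogonal to its kernel with
    [phi u != 0].  For every [z] the vector [z - (phi z / phi u) u] lies in
    the kernel, hence is orthogonal to [u], and this determines [<z, u>] up to
    a factor that rescaling [u] absorbs. *)
Lemma riesz (phi : H -> K) (c : R) :
  (forall a x y, phi (a *: x + y) = a * phi x + phi y) ->
  (forall x, re_scalar `|phi x| <= c * hnorm x) ->
  exists x, forall z, phi z = inner z x.
Proof.
move=> phiL phiB.
have phi0 : phi 0 = 0.
  by have := phiL (-1) 0 0; rewrite scaler0 addr0 mulN1r addNr.
have cker : closed_subspace [set x | phi x = 0].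
  split; first by split=> // a x y /= px py; rewrite phiL px py mulr0 addr0.
  move=> x /closure_hnorm clx /=; apply: normr0_eq0.
  rewrite -[`|_|]re_scalarK // -[RHS](@of_real0 R k); congr of_real.
  apply/eqP; rewrite eq_le re_normr_ge0 andbT.
  apply/ler_addgt0Pr => e e0; rewrite add0r.
  have [|y /= py xy] := clx (e / (`|c| + 1)).
    by rewrite divr_gt0 // ltr_wpDl.
  have -> : phi x = phi (x - y).
    by rewrite addrC -scaleN1r phiL py mulr0 add0r.
  apply: le_trans (phiB _) _.
  rewrite ltr_pdivlMr ?ltr_wpDl // in xy.
  have := ler_norm c; have := normr_ge0 c; have := hnorm_ge0 (x - y).
  by nra.
have [allker|/existsNP[f fker]] := pselect (forall f, phi f = 0).
  by exists 0 => z; rewrite allker inner0r.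
have [pk ok] := orthprojP f cker; set p := orthproj _ f in pk ok.
pose u := f - p.
have pu : phi u = phi f.
  by rewrite /u addrC -scaleN1r phiL (pk : phi p = 0) mulr0 add0r.
have pu0 : phi u != 0 by rewrite pu; apply/eqP.
have u0 : inner u u != 0.
  by apply: contra_neq pu0 => /inner_eq0 ->.
exists (conj_scalar (phi u / inner u u) *: u) => z.
rewrite innerZr conj_scalarK.
have zk : phi (- (phi z / phi u) *: u + z) = 0.
  by rewrite phiL mulNr divfK // addNr.
have /inner_eq0C := ok _ zk; rewrite -/u innerDl innerZl => /eqP.
rewrite addrC mulNr subr_eq0 => /eqP ->.
by rewrite mulrCA !divfK.
Qed.

Lemma adjointP (T : {linear H -> G}) (y : G) : bounded_operator T ->
  forall z, inner (T z) y = inner z (adjoint T y).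
Proof.
move=> [c Tc].
apply: (@xgetPex _ 0 [set x | forall z, inner (T z) y = inner z x]).
apply: (@riesz (fun z => inner (T z) y) (c * hnorm y)) => [a u w|z].
  by rewrite linearP innerDl innerZl.
apply: le_trans (cauchy_schwarz _ _) _.
by rewrite mulrAC ler_wpM2r ?hnorm_ge0.
Qed.

End Riesz.

(** * The norm of the Hilbert direct sum *)

Section L2SumNorm.
Context {R : realType} {k : scalar_kind} {J : set int}.
Context {Hs : J -> hilbertType R k}.

Lemma le_l2norm (g : forall j, Hs j) j :
  ((hnorm (g j) ^+ 2)%:E <= l2norm_sqr g)%E.
Proof.
apply: esum_ge; exists [set j]; first by split.
by rewrite fsbig_set1.
Qed.

(** Squared triangle inequality, with [2 x + 2 y] spelled as a sum so that it
    follows from additivity of the sums alone. *)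
Lemma l2norm_dist (g a b : forall j, Hs j) (x y : R) :
  (l2norm_sqr (fun j => g j - a j)%R <= x%:E)%E ->
  (l2norm_sqr (fun j => g j - b j)%R <= y%:E)%E ->
  (l2norm_sqr (fun j => a j - b j)%R <= (x + x + (y + y))%:E)%E.
Proof.
move=> gx gy; rewrite !EFinD.
apply: le_trans (leeD (leeD gx gx) (leeD gy gy)).
rewrite /l2norm_sqr -!esumD;
  try by move=> j _; rewrite -?EFinD lee_fin ?addr_ge0 ?sqr_ge0.
apply: le_esum => j _; rewrite -!EFinD lee_fin.
have := parallelogram (g j - a j) (g j - b j).
have -> : (g j - a j) - (g j - b j) = b j - a j.
  by rewrite opprB addrC addrA subrK.
rewrite (hnorm_distC (b j)) => par.
have := sqr_ge0 (hnorm (g j - a j + (g j - b j))); lra.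
Qed.

End L2SumNorm.

(** * The analysis map of a g-fusion system *)

Section Analysis.
Context {R : realType} {k : scalar_kind} {J : set int}.
Context {H : hilbertType R k} {Hs : J -> hilbertType R k}.
Variables (W : J -> set H) (L : forall j : J, {linear H -> Hs j}) (v : J -> R).
Hypothesis HW : forall j, closed_subspace (W j).
Hypothesis HL : forall j, bounded_operator (L j).
Local Notation K := (scalar_field R k).
Local Notation T := (gfusion_analysis W L v).
Local Notation M := (gfusion_span W L).

Lemma analysis_linear (a : K) f g j : T (a *: f + g) j = a *: T f j + T g j.
Proof.
by rewrite /gfusion_analysis orthproj_linear // linearP scalerDr !scalerA mulrC.
Qed.

Lemma analysisB f g j : T (f - g) j = T f j - T g j.
Proof. by rewrite addrC -scaleN1r analysis_linear scaleN1r addrC. Qed.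

Lemma hnorm_analysis f j :
  hnorm (T f j) ^+ 2 = v j ^+ 2 * hnorm (L j (orthproj (W j) f)) ^+ 2.
Proof.
rewrite /gfusion_analysis hnormZ exprMn; congr (_ * _).
apply: (@of_real_inj R k); rewrite !of_realX re_scalarK //.
by rewrite -mul_conj_scalar conj_of_real expr2.
Qed.

Lemma l2norm_analysis f : l2norm_sqr (T f) =
  (\esum_(j in [set: J])
     (v j ^+ 2 * hnorm (L j (orthproj (W j) f)) ^+ 2)%:E)%E.
Proof. by apply: eq_esum => j _; rewrite hnorm_analysis. Qed.

Lemma analysis_bounded j : exists2 c : R, 0 < c &
  forall f, hnorm (T f j) <= c * hnorm f.
Proof.
have [c Lc] := HL j.
(* The summand 1 makes the constant positive, so that it can be divided by. *)
exists (re_scalar `|of_real k (v j)| * `|c| + 1) => [|f].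
  by rewrite ltr_wpDl // mulr_ge0 ?re_normr_ge0.
rewrite /gfusion_analysis hnormZ mulrDl -mulrA mul1r.
apply: ler_wpDr; first exact: hnorm_ge0.
apply: ler_wpM2l; [exact: re_normr_ge0 | apply: le_trans (Lc _) _].
apply: (@le_trans _ _ (`|c| * hnorm (orthproj (W j) f))).
  by rewrite ler_wpM2r ?hnorm_ge0 ?ler_norm.
by rewrite ler_wpM2l // hnorm_orthproj.
Qed.

Lemma span_closed_subspace : closed_subspace M.
Proof. exact: closed_span_subspace. Qed.

(** [L_j P_j f] is orthogonal to itself: moving [L_j] and [P_j] to the other
    side of the inner product produces an element of [M]. *)
Lemma analysis_orthogonal f :
  (forall m, M m -> inner f m = 0) -> forall j, T f j = 0.
Proof.
move=> fM j; rewrite /gfusion_analysis.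
suff -> : L j (orthproj (W j) f) = 0 by rewrite scaler0.
apply: inner_eq0; rewrite adjointP // orthproj_selfadjoint //.
by apply: fM; apply: sub_closed_span; exists j.
Qed.

Lemma analysis_orthproj f : T (orthproj M f) = T f.
Proof.
have [_ of_] := orthprojP f span_closed_subspace.
apply/esym/functional_extensionality_dep => j; apply/subr0_eq.
by rewrite -analysisB analysis_orthogonal.
Qed.

(** The restriction of the analysis map to [M] is bounded below, so
    convergence of images forces convergence of preimages; boundedness of
    each coordinate identifies the limit, without continuity of the map into
    the direct sum. *)
Lemma range_analysis_closed : gfusion_frame_sequence W L v ->
  l2_closed_subspace (range T).
Proof.
move=> [A [B [A0 AB frame]]]; have [Ms clM] := span_closed_subspace.
split.
- move=> _ [f _ <-]; rewrite -analysis_orthproj /l2sum /= l2norm_analysis.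
  have [Mf _] := orthprojP f span_closed_subspace.
  by have /andP[_ /le_lt_trans] := frame _ Mf; apply; exact: ltry.
- exists 0 => //; apply/functional_extensionality_dep => j.
  by rewrite -[X in T X](subrr (0 : H)) analysisB subrr.
- move=> a _ _ [f _ <-] [g _ <-]; exists (a *: f + g) => //.
  by apply/functional_extensionality_dep => j; exact: analysis_linear.
move=> g _ approx.
(* Preimages are projected onto [M], where the lower bound is available. *)
have /choice[u uP] n : exists f, M f /\
    (l2norm_sqr (fun j => g j - T f j)%R <= (n.+1%:R^-1)%:E)%E.
  have [|_ [f _ <-] gf] := approx n.+1%:R^-1; first by rewrite invr_gt0 ltr0Sn.
  have [Mf _] := orthprojP f span_closed_subspace.
  exists (orthproj M f); split=> //; rewrite analysis_orthproj.
  apply: le_trans (ltW gf) _; rewrite lee_fin expr2 ler_piMl ?invr_ge0 //.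
  by rewrite invf_le1 ?ltr0Sn // ler1n.
have [|n m|f Mf uf] := @closed_quasi_cauchy _ _ _ M (2 / A) u clM.
- by move=> n; have [] := uP n.
- have [Mn gn] := uP n; have [Mm gm] := uP m.
  have := l2norm_dist gn gm.
  rewrite (_ : (fun j => T (u n) j - T (u m) j) = T (u n - u m)); last first.
    by apply/functional_extensionality_dep => j; rewrite analysisB.
  have /andP[low _] := frame _ (subspaceB Ms Mn Mm).
  rewrite l2norm_analysis => /(le_trans low); rewrite lee_fin => Au.
  rewrite mulrAC ler_pdivlMr // mulrC; apply: le_trans Au _.
  by rewrite mulr_natl mulr2n addrACA.
exists f => //; apply/functional_extensionality_dep => j.
apply/subr0_eq/hnorm0_eq0/eqP.
rewrite eq_le hnorm_ge0 andbT; apply/ler_addgt0Pr => e e0; rewrite add0r.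
(* The j-th coordinate of [T (u n)] tends both to [T f j] and to [g j]. *)
have [c c0 Tc] := analysis_bounded j.
have [|N1 N1P] := uf (e / (2 * c)); first by rewrite divr_gt0 ?mulr_gt0.
have [|N2 N2P] := @inv_succ_small R ((e / 2) ^+ 2).
  by rewrite exprn_gt0 ?divr_gt0.
pose n := maxn N1 N2.
have fu := N1P n (leq_maxl _ _); have n2 := N2P n (leq_maxr _ _).
have [_ gu] := uP n.
have := le_trans (le_l2norm (fun j => g j - T (u n) j) j) gu.
rewrite lee_fin => /le_lt_trans/(_ n2).
rewrite ltr_pXn2r ?nnegrE ?hnorm_ge0 // ?divr_ge0 ?(ltW e0) // => gj.
have := Tc (f - u n); rewrite analysisB => fj.
have := ler_hnormD (T f j - T (u n) j) (T (u n) j - g j).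
rewrite addrA subrK (hnorm_distC (T (u n) j)).
rewrite ltr_pdivlMr ?mulr_gt0 // in fu.
nra.
Qed.

Lemma frame_analysis_injective : gfusion_frame W L v -> injective T.
Proof.
move=> [A [B [A0 AB frame]]] f g Tfg.
apply/subr0_eq/hnorm0_eq0/eqP.
have /andP[+ _] := frame (f - g) I.
rewrite -l2norm_analysis (_ : T (f - g) = fun=> 0); last first.
  by apply/functional_extensionality_dep => j; rewrite analysisB Tfg subrr.
rewrite /l2norm_sqr esum1 => [|j _]; last by rewrite hnorm0 expr0n.
rewrite lee_fin pmulr_rle0 // => fg0.
by rewrite -sqrf_eq0 eq_le fg0 sqr_ge0.
Qed.

(** A vector and its projection onto [M] have the same image, so injectivity
    makes [M] the whole space. *)
Lemma analysis_injective_frame : gfusion_frame_sequence W L v ->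
  injective T -> gfusion_frame W L v.
Proof.
move=> [A [B [A0 AB frame]]] Tinj; exists A, B; split=> // f _.
have [Mf _] := orthprojP f span_closed_subspace.
by apply: frame; rewrite -(Tinj _ _ (analysis_orthproj f)).
Qed.

End Analysis.

Theorem theorem4p5 (R : realType) (k : scalar_kind) (J : set int)
    (H : hilbertType R k) (Hs : J -> hilbertType R k)
    (W : J -> set H) (L : forall j : J, {linear H -> Hs j}) (v : J -> R)
    (Hsep : separable H)
    (HW : forall j, closed_subspace (W j))
    (HL : forall j, bounded_operator (L j))
    (Hv : forall j, 0 < v j)
    (Hseq : gfusion_frame_sequence W L v) :
  l2_closed_subspace (range (gfusion_analysis W L v)) /\
  (gfusion_frame W L v <-> injective (gfusion_analysis W L v)).
Proof.
split; first exact: range_analysis_closed.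
by split=> [/frame_analysis_injective|/analysis_injective_frame]; apply.
Qed.
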